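(* Let $h(x)=\sum_{k\ge1}h_kx^k\in\mathbb{K}[[x]]$ with $h_k\ne0$ for all $k\ge1$, let $q\in\mathbb{K}[[x]]$, $y_0\in\mathbb{K}$, and let $T:\mathbb{K}[[x]]\to\mathbb{K}[[x]]$ be a non-expansive $\mathbb{K}$-linear endomorphism. Then the problem $\mathcal{D}_h(y)=T(y)+q$, $y(0)=y_0$, has a unique solution $y\in\mathbb{K}[[x]]$, given by $$y=\frac{1}{1-x}(\mathcal{I}_h\circ T)\big(y_0+\mathcal{I}_h(q)\big)=\sum_{k\ge0}(\mathcal{I}_h\circ T)^k\big(y_0+\mathcal{I}_h(q)\big).$$
   Context: $\mathbb{K}$ is a field of characteristic zero; on $\mathbb{K}[[x]]$, $d(f,g)=2^{-\omega(f-g)}$ where $\omega$ is the order (index of the first nonzero coefficient), $d(f,f)=0$. Non-expansive means $d(T(f),T(g))\le d(f,g)$. The $h$-derivative is $\mathcal{D}_h\big(\sum_{k\ge0}s_kx^k\big)=\sum_{k\ge1}h_ks_kx^{k-1}$ and the $h$-integral is $\mathcal{I}_h\big(\sum_{k\ge0}s_kx^k\big)=\sum_{k\ge0}\frac{s_k}{h_{k+1}}x^{k+1}$. For a power series $f=\sum f_nx^n$ and a contractive linear operator $S$ (i.e. $c$-Lipschitz for $d$ with $c<1$), $f(S)=\sum_{n\ge0}f_nS^n$, the series converging in $d$; here $S=\mathcal{I}_h\circ T$ is contractive and $\frac{1}{1-x}(S)=\sum_{k\ge0}S^k$. *)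

(* Defs.v *)
From HB Require Import structures.
From mathcomp Require Import all_boot all_order all_algebra.
From mathcomp Require Import all_classical all_reals all_analysis.
Set Implicit Arguments.
Unset Strict Implicit.
Unset Printing Implicit Defensive.
Import Order.TTheory GRing.Theory Num.Theory numFieldNormedType.Exports.
Local Open Scope classical_set_scope.
Local Open Scope ring_scope.

(* K[[x]], as coefficient sequences: [f n] is the coefficient of x^n.  The
   K-module structure is the one of functions; beware that [*] would be their
   pointwise product, whereas the product of power series is [fps_mul].  [K^o]
   is K as a module over itself. *)
Definition fps (K : fieldType) : Type := nat -> K^o.

Definition fps_const (K : fieldType) (c : K) : fps K :=
  fun n => if n == 0 then c else 0.

Definition fpsX (K : fieldType) : fps K := fun n => (n == 1)%:R.

Definition fps_mul (K : fieldType) (f g : fps K) : fps K :=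
  fun n => \sum_(i < n.+1) f i * g (n - i)%N.

(* The series 1/(1-x); see [fps_geomP]. *)
Definition fps_geom (K : fieldType) : fps K := fun=> 1.

Lemma fps_geomP (K : fieldType) :
  fps_mul (fps_const 1 - fpsX K) (fps_geom K) = fps_const 1.
Proof.
apply/funext => n; rewrite /fps_mul /fps_geom.
under eq_bigr do rewrite mulr1.
rewrite big_ord_recl /= /fps_const /fpsX.
have E m : (fps_const 1 - fpsX K) m = (m == 0)%:R - (m == 1)%:R :> K.
  by rewrite /fps_const /fpsX; case: m.
case: n => [|n]; first by rewrite big_ord0 E subr0 addr0.
rewrite big_ord_recl !E big1 => [|i _]; last by rewrite E subr0.
by rewrite subr0 sub0r addr0 subrr.
Qed.

(* [None] stands for the infinite order of the zero series. *)
Definition fps_order (K : fieldType) (f : fps K) : option nat :=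
  if pselect (exists n, (f n : K) != 0) is left nz then Some (ex_minn nz)
  else None.

Definition fps_dist (R : realType) (K : fieldType) (f g : fps K) : R :=
  if fps_order (f - g) is Some n then 2 ^- n else 0.

Definition fps_lipschitz (R : realType) (K : fieldType) (c : R)
    (S : fps K -> fps K) : Prop :=
  forall f g, fps_dist R (S f) (S g) <= c * fps_dist R f g.

Definition nonexpansive (R : realType) (K : fieldType)
    (S : fps K -> fps K) : Prop :=
  forall f g, fps_dist R (S f) (S g) <= fps_dist R f g.

Definition contractive (R : realType) (K : fieldType)
    (S : fps K -> fps K) : Prop :=
  exists c : R, [/\ 0 <= c, c < 1 & fps_lipschitz c S].

Definition fps_cvg (R : realType) (K : fieldType) (u : nat -> fps K)
    (l : fps K) : Prop :=
  fps_dist R (u n) l @[n --> \oo] --> (0 : R).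

Definition fps_sums_to (R : realType) (K : fieldType) (a : nat -> fps K)
    (l : fps K) : Prop :=
  fps_cvg R (fun n => \sum_(0 <= k < n) a k) l.

(* The value f(S)(g), i.e. the sum of the series of the f_n S^n(g); it is 0 by
   convention when that series diverges, which never happens for S linear and
   contractive. *)
Definition fps_apply (R : realType) (K : fieldType) (f : fps K)
    (S : fps K -> fps K) (g : fps K) : fps K :=
  xget 0 [set l | fps_sums_to R (fun n => (f n : K) *: iter n S g) l].

Definition hderive (K : fieldType) (h f : fps K) : fps K :=
  fun n => h n.+1 * f n.+1.

Definition hintegral (K : fieldType) (h f : fps K) : fps K :=
  fun n => if n is k.+1 then f k / h k.+1 else 0.

(* Main.v *)
(** Write [f = g mod x^n] when [f] and [g] have the same first [n]
    coefficients; this says [d(f,g) <= 2^-n].  A non-expansive [T] preserves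
    these congruences and [I_h] raises their exponent by one, so [S = I_h o T]
    is 1/2-Lipschitz.  Since the [h_k] are invertible, the problem is equivalent
    to the fixed-point equation [y = v + S y].  The partial sums [u_n] of
    [sum_k S^k v] satisfy [u_(n+1) = v + S u_n], so they are the Picard iterates
    of this equation: [u_n] is congruent mod [x^n] to any fixed point, and the
    diagonal of [u] is a fixed point. *)

Require Import Defs.
From HB Require Import structures.
From mathcomp Require Import all_boot all_order all_algebra.
From mathcomp Require Import all_classical all_reals all_analysis.
Set Implicit Arguments.
Unset Strict Implicit.
Unset Printing Implicit Defensive.
Import Order.TTheory GRing.Theory Num.Theory numFieldNormedType.Exports.
Local Open Scope classical_set_scope.
Local Open Scope ring_scope.

Definition eq_upto (K : fieldType) (n : nat) (f g : fps K) : Prop :=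
  forall m, (m < n)%N -> f m = g m.

Section EqUpto.
Context {K : fieldType}.
Implicit Types (f g : fps K) (n : nat).

Lemma eq_upto_sym n f g : eq_upto n f g -> eq_upto n g f.
Proof. by move=> fg m /fg. Qed.

Lemma eq_upto_trans n f g k : eq_upto n f g -> eq_upto n g k -> eq_upto n f k.
Proof. by move=> fg gk m mn; rewrite fg// gk. Qed.

Lemma eq_uptoS n f g : eq_upto n.+1 f g -> eq_upto n f g.
Proof. by move=> fg m mn; apply: fg; exact: ltnW. Qed.

Lemma eq_uptoDl n v f g : eq_upto n f g -> eq_upto n (v + f) (v + g).
Proof.
by move=> fg m mn; rewrite !/(_ + _) /=; congr (_ + _); exact: fg.
Qed.

Lemma eq_upto_all f g : (forall n, eq_upto n f g) -> f = g.
Proof. by move=> fg; apply/funext => n; exact: (fg n.+1). Qed.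

Lemma eq_upto_hintegral h n f g :
  eq_upto n f g -> eq_upto n.+1 (hintegral h f) (hintegral h g).
Proof. by move=> fg [|m]//= mn; rewrite fg. Qed.

End EqUpto.

Section Distance.
Context (R : realType) {K : fieldType}.
Implicit Types (f g : fps K) (n : nat).

Lemma ler_expVn2 m n : (2 ^- m <= 2 ^- n :> R) = (n <= m)%N.
Proof. by rewrite lef_pV2 ?posrE ?exprn_gt0// ler_eXn2l// ltr1n. Qed.

Variant fps_dist_spec f g : R -> Prop :=
  | FpsDistEq of f = g : fps_dist_spec f g 0
  | FpsDistNeq n of eq_upto n f g & f n <> g n : fps_dist_spec f g (2 ^- n).

Lemma fps_distP f g : fps_dist_spec f g (fps_dist R f g).
Proof.
rewrite /fps_dist /fps_order; case: pselect => [nz|z].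
  case: ex_minnP => n fgn nmin; constructor.
    move=> m mn; apply: contraTeq mn => fgm; rewrite -leqNgt.
    by apply: nmin; rewrite subr_eq0.
  by apply/eqP; rewrite -subr_eq0.
constructor; apply/funext => n; apply: contra_notP z => /eqP fgn.
by exists n; rewrite subr_eq0.
Qed.

Lemma fps_dist_ge0 f g : 0 <= fps_dist R f g.
Proof. by case: fps_distP => // n _ _; rewrite invr_ge0 exprn_ge0. Qed.

(** The bridge from the metric to congruences: a nonzero distance is [2 ^- m] with [m] the first
    index of disagreement, and [2 ^- m <= 2 ^- n] means [n <= m]. *)
Lemma fps_dist_le n f g : fps_dist R f g <= 2 ^- n <-> eq_upto n f g.
Proof.
case: fps_distP => [->|m fgm neq].
  by split=> // _; rewrite invr_ge0 exprn_ge0.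
rewrite ler_expVn2; split=> [nm k kn|fgn].
  by apply: fgm; exact: leq_trans nm.
by rewrite leqNgt; apply/negP => /fgn.
Qed.

Lemma nonexpansive_eq_upto {T : fps K -> fps K} n f g :
  nonexpansive R T -> eq_upto n f g -> eq_upto n (T f) (T g).
Proof. by move=> Tne /fps_dist_le fg; apply/fps_dist_le/(le_trans (Tne f g)). Qed.

(** The ratio is 1/2: if [f] and [g] first differ at index [n], their images agree up to [n.+1],
    which halves the bound. *)
Lemma contractive_eq_upto (S : fps K -> fps K) :
    (forall n f g, eq_upto n f g -> eq_upto n.+1 (S f) (S g)) ->
  contractive R S.
Proof.
move=> Sc; exists 2^-1; split; rewrite ?invr_ge0 ?invf_lt1 ?ltr1n// => f g.
case: (fps_distP f g) => [->|n /Sc/fps_dist_le SfSg _].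
  by rewrite mulr0; case: fps_distP => // n _.
by rewrite -invfM -exprS.
Qed.

Lemma fps_cvgP (u : nat -> fps K) l :
  fps_cvg R u l <-> forall n, \forall k \near \oo, eq_upto n (u k) l.
Proof.
split=> [ul n|ul].
  have /cvgrPdist_le/(_ (2 ^- n)) := ul.
  rewrite invr_gt0 exprn_gt0// => /(_ isT); apply: filterS => k.
  by rewrite sub0r normrN ger0_norm ?fps_dist_ge0// => /fps_dist_le.
apply/cvgrPdist_le => e e0.
(* The balls of radius [2 ^- n] suffice, since the powers of 1/2 tend to 0. *)
have [n ne] : exists n, 2 ^- n <= e :> R.
  have /cvgrPdist_le/(_ _ e0)[n _ /(_ n (leqnn n))] :
      (2^-1 : R) ^+ n @[n --> \oo] --> (0 : R).
    by apply: cvg_expr; rewrite ger0_norm ?invr_ge0// invf_lt1 ?ltr1n.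
  rewrite sub0r normrN ger0_norm ?exprn_ge0 ?invr_ge0// exprVn.
  by exists n.
apply: filterS (ul n) => k /fps_dist_le ukl.
by rewrite sub0r normrN ger0_norm ?fps_dist_ge0// (le_trans ukl).
Qed.

Lemma fps_cvg_unique (u : nat -> fps K) l l' :
  fps_cvg R u l -> fps_cvg R u l' -> l = l'.
Proof.
move=> /fps_cvgP ul /fps_cvgP ul'; apply: eq_upto_all => n.
have [k [/eq_upto_sym + kl']] := filter_ex (filterI (ul n) (ul' n)).
by move=> /eq_upto_trans; apply.
Qed.

(** Uniqueness of limits forces the value chosen by [xget]; all coefficients of the geometric series
    are 1. *)
Lemma fps_apply_geom (S : fps K -> fps K) g l :
  fps_sums_to R (fun k => iter k S g) l -> fps_apply R (fps_geom K) S g = l.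
Proof.
have E : (fun n => (fps_geom K n : K) *: iter n S g) = (fun n => iter n S g).
  by apply/funext => n; rewrite scale1r.
move=> gl; rewrite /fps_apply E; apply: xget_unique => // l' gl'.
exact: fps_cvg_unique gl' gl.
Qed.

End Distance.

Lemma hintegral_is_linear (K : fieldType) (h : fps K) : linear (hintegral h).
Proof.
move=> a f g; apply/funext => -[|n].
  by transitivity (a * 0 + 0 : K); rewrite // mulr0 addr0.
by rewrite /= mulrDl -mulrA.
Qed.

HB.instance Definition _ (K : fieldType) (h : fps K) :=
  GRing.isLinear.Build K (fps K) (fps K) *:%R (hintegral h)
    (hintegral_is_linear h).

Section Picard.
Context {K : fieldType} (S : {linear fps K -> fps K}) (v : fps K).
Hypothesis Sc : forall n f g, eq_upto n f g -> eq_upto n.+1 (S f) (S g).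

Let u n : fps K := \sum_(0 <= k < n) iter k S v.

(** Split off the term [k = 0] and pull [S] out of the rest by additivity. *)
Lemma iter_sumS n : u n.+1 = v + S (u n).
Proof. by rewrite /u big_nat_recl// raddf_sum. Qed.

(** Each Picard step gains one correct coefficient; the start [n = 0] is vacuous. *)
Lemma iter_sum_eq_upto y n : y = v + S y -> eq_upto n (u n) y.
Proof.
move=> yE; elim: n => [|n IHn]; first by [].
by rewrite iter_sumS yE; exact/eq_uptoDl/Sc.
Qed.

Lemma fixpoint_unique y z : y = v + S y -> z = v + S z -> y = z.
Proof.
move=> yE zE; apply: eq_upto_all => n.
exact: eq_upto_trans (eq_upto_sym (iter_sum_eq_upto yE))
  (iter_sum_eq_upto zE).
Qed.

Lemma fixpoint_sums_to (R : realType) y :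
  y = v + S y -> fps_sums_to R (fun k => iter k S v) y.
Proof.
move=> yE; apply/fps_cvgP => n; exists n => // k /= nk m mn.
by apply: (iter_sum_eq_upto yE); exact: leq_trans nk.
Qed.

Lemma iter_sum_cauchy m n : (m <= n)%N -> eq_upto m (u m) (u n).
Proof.
elim: m n => [//|m IHm] [//|n] mn.
by rewrite !iter_sumS; exact/eq_uptoDl/Sc/IHm.
Qed.

Lemma fixpoint_exists : exists y, y = v + S y.
Proof.
(* The coefficient of index [m] is settled from [u m.+1] on, but not yet in [u m]. *)
pose y : fps K := fun m => u m.+1 m.
have uy n : eq_upto n (u n) y.
  by move=> m mn; symmetry; exact: iter_sum_cauchy.
(* Modulo x^(n+1), [y] is congruent to [u n.+1], which is [v + S (u n)], hence to [v + S y]. *)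
exists y; apply: eq_upto_all => n; apply: eq_uptoS.
apply: eq_upto_trans (eq_upto_sym (uy _)) _.
by rewrite iter_sumS; exact/eq_uptoDl/Sc.
Qed.

End Picard.

(** Coefficient 0 carries the initial condition; each later one is determined through division by
    some [h k.+1]. *)
Lemma hderive_eq_fixpoint {K : fieldType} (h f y : fps K) (y0 : K) :
    (forall k, (0 < k)%N -> h k <> 0) ->
  (hderive h y = f /\ y 0%N = y0) <-> y = fps_const y0 + hintegral h f.
Proof.
move=> hn0; have hk k : (h k.+1 : K) != 0 by apply/eqP; exact: hn0.
split=> [[<- <-]|->].
  apply/funext => -[|n]; rewrite !/(_ + _) /=; first by rewrite addr0.
  by rewrite add0r /hderive mulrC mulKf.
split; last by rewrite !/(_ + _) /= addr0.
by apply/funext => n; rewrite /hderive !/(_ + _) /= add0r mulrC divfK.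
Qed.

Theorem mainTheorem5 (R : realType) (K : fieldType)
    (charK : [pchar K] =i pred0)
    (h : fps K) (h0 : h 0%N = 0) (hn0 : forall k : nat, (0 < k)%N -> h k <> 0)
    (q : fps K) (y0 : K)
    (T : {linear fps K -> fps K}) (Tne : nonexpansive R T) :
  let S : fps K -> fps K := hintegral h \o T in
  let v : fps K := fps_const y0 + hintegral h q in
  [/\ contractive R S,
      exists! y : fps K, hderive h y = T y + q /\ y 0%N = y0
    & forall y : fps K, hderive h y = T y + q -> y 0%N = y0 ->
        y = fps_apply R (fps_geom K) S v /\
        fps_sums_to R (fun k => iter k S v) y].
Proof.
move=> S v.
have Sc n f g : eq_upto n f g -> eq_upto n.+1 (S f) (S g).
  by move=> fg; exact/eq_upto_hintegral/(nonexpansive_eq_upto Tne).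
(* The map [S] again, now with the linear structure that the Picard lemmas require. *)
pose SL : {linear fps K -> fps K} := hintegral h \o T.
have solP y : (hderive h y = T y + q /\ y 0%N = y0) <-> y = v + SL y.
  (* Here [f] is [T y + q], and additivity of [hintegral h] separates [S y] from the constant part
     [v]. *)
  rewrite hderive_eq_fixpoint// raddfD /v /SL /= -addrA.
  by rewrite [hintegral h q + _]addrC.
split; first exact: contractive_eq_upto.
  have [y yE] := fixpoint_exists (S := SL) v Sc.
  exists y; split=> [|z /solP zE]; first exact/solP.
  exact: (fixpoint_unique (S := SL) Sc yE zE).
move=> y Dy y0E; have yE : y = v + SL y by exact/solP.
have sy := fixpoint_sums_to (S := SL) Sc (R := R) yE.
by split=> //; rewrite (fps_apply_geom sy).
Qed.
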